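(* Let $d$ be an algebraic integer, $K=\mathbb{Q}(d)$, and let $f(x)\in\mathbb{Z}[x]$ be the minimal polynomial of $d$, of degree $n$. Suppose that $K/\mathbb{Q}$ is a Galois extension. Let $p$ be a prime number and $k=\mathbb{Z}/p\mathbb{Z}$. Write $$pO_K=(\mathfrak{P}_1\cdots\mathfrak{P}_g)^e,$$ where the $\mathfrak{P}_i$ are distinct prime ideals of $O_K$ with $h(\mathfrak{P}_i)=h$ for all $i=1,\dots,g$. Then $f$ factorizes modulo $p$ as $$\bar f(x)=(f_1\cdots f_g)^e \pmod p,$$ where $f_i\in k[x]$ with $\deg f_i=h$ for all $i$, and each $f_i$ is of the form $f_i=g_i^{e_i'}$ for some irreducible $g_i\in k[x]$ and some integer $e_i'\ge 1$.
   Context: $O_K$ denotes the ring of algebraic integers contained in $K$. For a prime ideal $\mathfrak{P}$ of $O_K$ with $\mathfrak{P}\cap\mathbb{Z}=p\mathbb{Z}$, $h(\mathfrak{P})=[O_K/\mathfrak{P}:\mathbb{Z}/p\mathbb{Z}]$ is the residue degree of $\mathfrak{P}$. (For $K/\mathbb{Q}$ Galois, all primes above $p$ have the same ramification index $e$ and residue degree $h$, and $n=ehg$.) $\bar f$ denotes the reduction of $f$ modulo $p$. *)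

(* Defs.v *)
From HB Require Import structures.
From mathcomp Require Import all_boot all_order all_algebra all_field.
Set Implicit Arguments. Unset Strict Implicit. Unset Printing Implicit Defensive.
Import Order.TTheory GRing.Theory Num.Theory.
Local Open Scope ring_scope.

Definition inK (d x : algC) : Prop :=
  exists q : {poly rat}, x = (map_poly ratr q).[d].

Definition inOK (d x : algC) : Prop := inK d x /\ x \in Aint.

Definition is_min_poly_Z (d : algC) (f : {poly int}) : Prop :=
  f \is monic /\ irreducible_poly (map_poly intr f : {poly rat})
  /\ root (map_poly intr f : {poly algC}) d.

(* K/Q Galois: K = Q(d) is normal, i.e. contains all conjugates of d *)
Definition galois_over_Q (d : algC) (f : {poly int}) : Prop :=
  forall z : algC, root (map_poly intr f : {poly algC}) z -> inK d z.

(* ideals of O_K are represented as predicates on algC contained in O_K *)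
Definition ideal_OK := algC -> Prop.

Definition is_ideal (d : algC) (I : ideal_OK) : Prop :=
  [/\ forall x, I x -> inOK d x,
      I 0,
      forall x y, I x -> I y -> I (x + y)
    & forall a x, inOK d a -> I x -> I (a * x)].

Definition is_prime_ideal (d : algC) (P : ideal_OK) : Prop :=
  [/\ is_ideal d P, ~ P 1
    & forall x y, inOK d x -> inOK d y -> P (x * y) -> P x \/ P y].

Definition ideal_eq (I J : ideal_OK) : Prop := forall x, I x <-> J x.

Definition ideal_unit (d : algC) : ideal_OK := inOK d.

Definition ideal_mul (I J : ideal_OK) : ideal_OK := fun x =>
  exists s : seq (algC * algC),
    (forall u, u \in s -> I u.1 /\ J u.2) /\ x = \sum_(u <- s) u.1 * u.2.

Definition ideal_prod (d : algC) (Is : seq ideal_OK) : ideal_OK :=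
  foldr ideal_mul (ideal_unit d) Is.

Definition ideal_exp (d : algC) (I : ideal_OK) (e : nat) : ideal_OK :=
  iter e (ideal_mul I) (ideal_unit d).

Definition ideal_pOK (d : algC) (p : nat) : ideal_OK := fun x =>
  exists y, inOK d y /\ x = p%:R * y.

(* residue degree h(P) = [O_K/P : Z/pZ] = h : there are w_1..w_h in O_K whose
   classes form an F_p-basis of O_K/P (spanning, and linearly independent mod p) *)
Definition residue_degree (d : algC) (p : nat) (P : ideal_OK) (h : nat) : Prop :=
  exists w : 'I_h -> algC,
    [/\ forall i, inOK d (w i),
        forall x, inOK d x -> exists c : 'I_h -> int,
            P (x - \sum_i (c i)%:~R * w i)
      & forall c : 'I_h -> int, P (\sum_i (c i)%:~R * w i) ->
            forall i, (p%:Z %| c i)%Z].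

(* Main.v *)
Require Import Defs.
From HB Require Import structures.
From mathcomp Require Import all_boot all_order all_algebra all_field.
From mathcomp Require Import ring.
From Stdlib Require Import Classical_Prop.
Import Order.TTheory GRing.Theory Num.Theory.
Local Open Scope ring_scope.

Set Implicit Arguments.
Unset Strict Implicit.

(** Both sides are the characteristic polynomial of multiplication by [d] on the
    [F_p]-vector space [O_K/pO_K].

    The hypothesis on [p O_K] makes every partial product [I] of the [P_i]
    invertible, so multiplication by an element of [I] outside [P_i I] identifies
    [O_K/P_i] with [I/P_i I].  Along the filtration of [O_K] by these partial
    products the characteristic polynomial is therefore [(F_1 ... F_g)^e], where
    [F_i] belongs to [O_K/P_i]; it is a power of the minimal polynomial of [d]
    modulo [P_i], which is irreducible because [P_i] is prime.

    On the other hand an [F_p]-basis [b] of [O_K/pO_K] lifts to a basis of [K]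
    such that [T d b = C b] with [C] integral and [T] prime to [p].  Over [Q] the
    characteristic polynomial of [C/T] is [f], so modulo [p] it is the reduction
    of [f]. *)

(** * Characteristic polynomials *)

(** Induction on [n]: a factor [G] of [p] is cancelled; without one, [p] is coprime to the power it
    divides, hence equal to [1]. *)
Lemma irreducible_pow_dvd (F : fieldType) (p G : {poly F}) n :
  irreducible_poly G -> G \is monic -> p \is monic -> p %| G ^+ n ->
  exists k, p = G ^+ k.
Proof.
move=> irrG monG; elim: n p => [|n IHn] p monp pG.
  exists 0%N; apply/eqP; rewrite expr0 -eqp_monic ?monic1 //.
  by rewrite -size_poly_eq1 -dvdp1 -(expr0 G).
case: (boolP (G %| p)) => [/dvdpP[q Dp]|nGp].
  have G0 : G != 0 by apply: monic_neq0.
  have monq : q \is monic by rewrite Dp monicMr in monp.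
  have [||k Dq] := IHn q => //.
    by rewrite -(dvdp_mul2r _ _ G0) -Dp -exprSr.
  by exists k.+1; rewrite Dp Dq exprSr.
have: coprimep p (G ^+ n.+1).
  by rewrite coprimep_expr // coprimep_sym irreducible_poly_coprime.
move/coprimepP/(_ p (dvdpp p) pG) => p1; exists 0%N.
by apply/eqP; rewrite expr0 -eqp_monic ?monic1.
Qed.

(* In M_n(R)[X], [G - G(A) = Q (X - A)]; take determinants. *)
Lemma char_poly_dvd_exp (F : fieldType) n (A : 'M[F]_n.+1) (G : {poly F}) :
  horner_mx A G = 0 -> char_poly A %| G ^+ n.+1.
Proof.
move=> GA0; have [phi [bij_phi phiZ phiC _]] := mx_poly_ring_isom F n.
have /factor_theorem[Q DQ] : root (map_poly scalar_mx G) A by apply/rootP.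
have [psi phiK psiK] := bij_phi.
(* The factorization is pulled back from [M_n(F)[X]] to [M_n(F[X])], where determinants are
   available. *)
have DG : G%:M = psi Q *m char_poly_mx A.
  apply: (bij_inj bij_phi); rewrite phiZ DQ.
  rewrite [RHS](rmorphM phi (psi Q) (char_poly_mx A)) psiK.
  by rewrite rmorphB phiC phiZ map_polyX.
by rewrite -det_scalar DG det_mulmx dvdp_mull.
Qed.

Lemma char_poly_irreducible_pow (F : fieldType) n (A : 'M[F]_n.+1) :
  irreducible_poly (mxminpoly A) ->
  exists k, char_poly A = mxminpoly A ^+ k.
Proof.
move=> irrG; apply: (@irreducible_pow_dvd _ _ _ n.+1) => //.
- exact: mxminpoly_monic.
- exact: char_poly_monic.
- exact/char_poly_dvd_exp/mx_root_minpoly.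
Qed.

Lemma char_poly_ublock (R : comNzRingType) m n (A : 'M[R]_m) (B : 'M[R]_n) C :
  char_poly (block_mx A C 0 B) = char_poly A * char_poly B.
Proof.
rewrite /char_poly /char_poly_mx map_block_mx scalar_mx_block opp_block_mx.
by rewrite add_block_mx map_mx0 oppr0 addr0 det_ublock.
Qed.

(* Reduction modulo [p] of the characteristic polynomial of [C / T] for [p] prime to
   [T], without leaving integral coefficients. *)
Definition scaled_char_poly (R : comNzRingType) n (T : R) (C : 'M[R]_n) :=
  \det ((T *: 'X)%:M - map_mx polyC C).

(** Used over the rationals with [M = C / T], and over ['F_p] with the reduced multiplication
    matrix, where [T ^+ n] is invertible and cancels. *)
Lemma scaled_char_polyZ (R : comNzRingType) n (T : R) (M : 'M[R]_n) :
  scaled_char_poly T (T *: M) = T ^+ n *: char_poly M.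
Proof.
rewrite /scaled_char_poly map_mxZ -mul_polyC -scale_scalar_mx -scalerBr detZ.
by rewrite -rmorphXn mul_polyC.
Qed.

Lemma map_scaled_char_poly (R S : comNzRingType) (phi : {rmorphism R -> S}) n
    (T : R) (C : 'M[R]_n) :
  map_poly phi (scaled_char_poly T C) = scaled_char_poly (phi T) (map_mx phi C).
Proof.
rewrite /scaled_char_poly -det_map_mx map_mxB map_scalar_mx /= map_polyZ map_polyX.
by rewrite -!map_mx_comp; congr (\det (_ - _)); apply/eq_map_mx => x; exact: map_polyC.
Qed.

Lemma eigenvector_root_char (F : fieldType) n (A : 'M[F]_n) (v : 'cV[F]_n) a :
  v != 0 -> A *m v = a *: v -> root (char_poly A) a.
Proof.
(* [eigenvalueP] speaks of row vectors, hence the passage to the transpose. *)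
move=> v0 Av; have <- : char_poly A^T = char_poly A.
  rewrite /char_poly -det_tr; congr (\det _); apply/matrixP => i j.
  by rewrite !mxE eq_sym.
rewrite -eigenvalue_root_char; apply/eigenvalueP; exists v^T.
  by rewrite -trmx_mul Av linearZ.
by rewrite trmx_eq0.
Qed.

(** * Ideals of the ring of integers *)

Local Notation "A ^Z" := (map_mx (intr : int -> algC) A)
  (at level 8, format "A ^Z").

Lemma inK_root (d : algC) : inK d d.
Proof. by exists 'X; rewrite map_polyX hornerX. Qed.

Lemma inKD d x y : inK d x -> inK d y -> inK d (x + y).
Proof. by case=> q -> [r ->]; exists (q + r); rewrite rmorphD hornerD. Qed.

Lemma inKM d x y : inK d x -> inK d y -> inK d (x * y).
Proof. by case=> q -> [r ->]; exists (q * r); rewrite rmorphM hornerM. Qed.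

Lemma inOKD d x y : inOK d x -> inOK d y -> inOK d (x + y).
Proof. by case=> ? ? [? ?]; split; [exact: inKD | exact: rpredD]. Qed.

Lemma inOKM d x y : inOK d x -> inOK d y -> inOK d (x * y).
Proof. by case=> ? ? [? ?]; split; [exact: inKM | exact: rpredM]. Qed.

Lemma inOK_int d (z : int) : inOK d z%:~R.
Proof.
split; last exact: Aint_int.
by exists z%:~R%:P; rewrite map_polyC hornerC /= rmorph_int.
Qed.

Lemma inOK_nat d n : inOK d n%:R.
Proof. exact: (inOK_int d n). Qed.

Lemma inOK0 d : inOK d 0. Proof. exact: inOK_nat d 0%N. Qed.
Lemma inOK1 d : inOK d 1. Proof. exact: inOK_nat d 1%N. Qed.

Lemma inOK_horner d (q : {poly int}) :
  inOK d d -> inOK d (map_poly intr q).[d].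
Proof.
move=> Od; elim/poly_ind: q => [|q c IHq].
  by rewrite rmorph0 horner0; apply: inOK0.
rewrite rmorphD rmorphM /= map_polyC map_polyX !hornerE.
by apply: inOKD (inOK_int _ _); apply: inOKM.
Qed.

Lemma inOK_ideal d : is_ideal d (inOK d).
Proof.
by split=> //; [exact: inOK0 | exact: inOKD | exact: inOKM].
Qed.

Lemma pOK_ideal d p : is_ideal d (ideal_pOK d p).
Proof.
split.
- by move=> _ [y [Oy ->]]; apply: inOKM (inOK_nat _ _) Oy.
- by exists 0; rewrite mulr0; split=> //; apply: inOK0.
- move=> _ _ [x [Ox ->]] [y [Oy ->]]; exists (x + y).
  by rewrite mulrDr; split=> //; apply: inOKD.
- move=> a _ Oa [y [Oy ->]]; exists (a * y).
  by rewrite mulrCA; split=> //; apply: inOKM.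
Qed.

Section IdealTheory.
Variables (d : algC) (I : ideal_OK).
Hypothesis idI : is_ideal d I.

Lemma ideal_sub x : I x -> inOK d x. Proof. by case: idI => h _ _ _; apply: h. Qed.
Lemma ideal0 : I 0. Proof. by case: idI. Qed.
Lemma idealD x y : I x -> I y -> I (x + y).
Proof. by case: idI => _ _ h _; apply: h. Qed.
Lemma idealMl a x : inOK d a -> I x -> I (a * x).
Proof. by case: idI => _ _ _ h; apply: h. Qed.
Lemma idealMr a x : inOK d a -> I x -> I (x * a).
Proof. by rewrite mulrC; apply: idealMl. Qed.
Lemma idealN x : I x -> I (- x).
Proof. by rewrite -mulN1r; apply: idealMl; apply: (inOK_int d (- 1)). Qed.
Lemma idealB x y : I x -> I y -> I (x - y).
Proof. by move=> Ix /idealN; apply: idealD. Qed.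

Lemma ideal_sum (T : Type) (r : seq T) (F : T -> algC) :
  (forall t, I (F t)) -> I (\sum_(t <- r) F t).
Proof. by move=> IF; apply: (big_ind I); [exact: ideal0 | exact: idealD |]. Qed.

Lemma ideal_mulmx m n k (C : 'M[int]_(m, n)) (b : 'M[algC]_(n, k)) i j :
  (forall l, I (b l j)) -> I ((C^Z *m b) i j).
Proof.
move=> Ib; rewrite mxE; apply: ideal_sum => l.
by rewrite mxE; apply: idealMl => //; apply: inOK_int.
Qed.

End IdealTheory.

Lemma ideal_mul_mem (I J : ideal_OK) a b : I a -> J b -> ideal_mul I J (a * b).
Proof.
move=> Ia Jb; exists [:: (a, b)]; split; last by rewrite big_seq1.
by move=> u; rewrite inE => /eqP ->.
Qed.

Lemma ideal_mul_ind (I J : ideal_OK) (Q : algC -> Prop) x :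
  Q 0 -> (forall y z, Q y -> Q z -> Q (y + z)) ->
  (forall a b, I a -> J b -> Q (a * b)) -> ideal_mul I J x -> Q x.
Proof.
move=> Q0 QD QM [s [IJs ->]]; rewrite big_seq; apply: (big_ind Q) => // u us.
by have [Iu Ju] := IJs u us; apply: QM.
Qed.

Lemma ideal_mul_ideal d I J :
  is_ideal d I -> is_ideal d J -> is_ideal d (ideal_mul I J).
Proof.
move=> idI idJ; split.
- move=> x; apply: ideal_mul_ind; [exact: inOK0 | exact: inOKD |].
  by move=> a b Ia Jb; apply: inOKM; [apply: (ideal_sub idI) | apply: (ideal_sub idJ)].
- by exists [::]; split=> //; rewrite big_nil.
- move=> _ _ [s [IJs ->]] [t [IJt ->]]; exists (s ++ t); rewrite big_cat.
  by split=> // u; rewrite mem_cat => /orP[/IJs | /IJt].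
- move=> a x Oa [s [IJs ->]]; exists [seq (a * u.1, u.2) | u <- s]; split.
    by move=> _ /mapP[u /IJs[Iu Ju] ->]; split=> //; apply: (idealMl idI).
  by rewrite big_map mulr_sumr; apply: eq_bigr => u _; rewrite mulrA.
Qed.

Lemma ideal_mul_subr d I J x : is_ideal d I -> is_ideal d J ->
  ideal_mul I J x -> J x.
Proof.
move=> idI idJ; apply: ideal_mul_ind; [exact: ideal0 idJ | exact: idealD idJ |].
by move=> a b Ia Jb; apply: (idealMl idJ) Jb; apply: (ideal_sub idI).
Qed.

Lemma ideal_mul_subl d I J x : is_ideal d I -> is_ideal d J ->
  ideal_mul I J x -> I x.
Proof.
move=> idI idJ; apply: ideal_mul_ind; [exact: ideal0 idI | exact: idealD idI |].
by move=> a b Ia Jb; apply: (idealMr idI) Ia; apply: (ideal_sub idJ).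
Qed.

Lemma ideal_mulA d I J K : is_ideal d I -> is_ideal d J -> is_ideal d K ->
  ideal_eq (ideal_mul (ideal_mul I J) K) (ideal_mul I (ideal_mul J K)).
Proof.
move=> idI idJ idK x.
have idIJ := ideal_mul_ideal idI idJ; have idJK := ideal_mul_ideal idJ idK.
have [idl idr] := (ideal_mul_ideal idIJ idK, ideal_mul_ideal idI idJK).
split; apply: ideal_mul_ind; [exact: ideal0 idr | exact: idealD idr | |
                              exact: ideal0 idl | exact: idealD idl |].
  move=> y c IJy Kc; move: IJy.
  apply: (ideal_mul_ind (Q := fun y => ideal_mul I (ideal_mul J K) (y * c))).
  - by rewrite mul0r; apply: ideal0 idr.
  - by move=> a b; rewrite mulrDl; apply: (idealD idr).
  - by move=> a b Ia Jb; rewrite -mulrA; do !apply: ideal_mul_mem.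
move=> a y Ia.
apply: (ideal_mul_ind (Q := fun y => ideal_mul (ideal_mul I J) K (a * y))).
- by rewrite mulr0; apply: ideal0 idl.
- by move=> b b'; rewrite mulrDr; apply: (idealD idl).
- by move=> b b' Ia' Jb; rewrite mulrA; do !apply: ideal_mul_mem.
Qed.

Lemma ideal_mul1 d I : is_ideal d I -> ideal_eq (ideal_mul (ideal_unit d) I) I.
Proof.
move=> idI x; split; first exact: ideal_mul_subr (inOK_ideal d) idI.
by rewrite -{2}[x]mul1r; apply: ideal_mul_mem; apply: inOK1.
Qed.

(** * Residue rings *)

Section ReductionModP.
Variable p : nat.
Hypothesis p_pr : prime p.

Lemma intr_Fp_eq0 (z : int) : (z%:~R == 0 :> 'F_p) = (p%:Z %| z)%Z.
Proof. by rewrite (dvdz_pcharf (pchar_Fp p_pr)). Qed.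

Lemma map_mx_Fp_eq0 m n (A : 'M[int]_(m, n)) :
  map_mx intr A = 0 :> 'M['F_p]_(m, n) <-> exists B, A = p%:Z *: B.
Proof.
split=> [A0 | [B ->]]; last first.
  by apply/matrixP=> i j; rewrite !mxE; apply/eqP; rewrite intr_Fp_eq0 dvdz_mulr.
exists (\matrix_(i, j) (A i j %/ p%:Z)%Z); apply/matrixP => i j; rewrite !mxE.
rewrite mulrC divzK // -intr_Fp_eq0.
by have /matrixP/(_ i j) := A0; rewrite !mxE => ->.
Qed.

Lemma map_poly_Fp_surj (A : {poly 'F_p}) :
  exists A0 : {poly int}, map_poly intr A0 = A.
Proof.
exists (map_poly (fun x : 'F_p => (x : nat)%:Z) A); apply/polyP => i.
by rewrite coef_map /= coef_map_id0 //= -pmulrn natr_Zp.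
Qed.

End ReductionModP.

(** A lift to [I] of an [F_p]-basis of [I/J]. Integer coefficients stand for the scalars, so no
    quotient is formed, and the column format turns combinations into matrix products. *)
Definition residue_basis (p : nat) (I J : ideal_OK) N (b : 'cV[algC]_N) :=
  [/\ forall i, I (b i 0),
      forall x, I x -> exists c : 'rV[int]_N, J (x - (c^Z *m b) 0 0)
    & forall c : 'rV[int]_N, J ((c^Z *m b) 0 0) ->
        forall i, (p%:Z %| c 0%R i)%Z].

Lemma residue_degree_basis d p P h : residue_degree d p P h ->
  exists w : 'cV[algC]_h, residue_basis p (inOK d) P w.
Proof.
case=> w [Ow span indep]; exists (\col_i w i).
have E (c : 'rV[int]_h) :
    (c^Z *m \col_i w i) 0 0 = \sum_i (c 0 i)%:~R * w i.
  by rewrite mxE; apply: eq_bigr => i _; rewrite !mxE.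
split=> [i | x /span[c Pc] | c]; first by rewrite mxE.
  exists (\row_i c i); rewrite E; set s := (X in x - X) in Pc *.
  by move: Pc; congr P; congr (_ - _); apply: eq_bigr => i _; rewrite mxE.
by rewrite E; apply: indep.
Qed.

Lemma mul_matrix_exists d p I J N (b : 'cV[algC]_N) :
  is_ideal d I -> inOK d d -> residue_basis p I J b ->
  exists M : 'M[int]_N, forall i, J ((d *: b - M^Z *m b) i 0).
Proof.
move=> idI Od [Ib span _].
have /fin_all_exists[M JM] (i : 'I_N) :
    exists c : 'rV[int]_N, J (d * b i 0 - (c^Z *m b) 0 0).
  by apply: span; apply: (idealMl idI).
exists (\matrix_i M i) => i; move: (JM i); congr J.
rewrite !mxE; congr (_ - _); apply: eq_bigr => j _.
by rewrite !mxE.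
Qed.

Section IdealsAboveP.
Variables (d : algC) (p : nat) (J : ideal_OK).
Hypotheses (p_pr : prime p) (idJ : is_ideal d J) (Jp : J p%:R).

Lemma ideal_mulmx_p m n k (B : 'M[int]_(m, n)) (b : 'M[algC]_(n, k)) i j :
  (forall l, inOK d (b l j)) -> J (((p%:Z *: B)^Z *m b) i j).
Proof.
move=> Ob; rewrite map_mxZ -scalemxAl mxE; apply: (idealMr idJ) Jp.
exact: (ideal_mulmx (inOK_ideal d)).
Qed.

(** Multiples of [p] fall into [J] because [p] does; conversely, independence of [b] applies to each
    row of [A]. *)
Lemma residue_basis_mulmx_eq0 I N (b : 'cV[algC]_N) m (A : 'M[int]_(m, N)) :
  is_ideal d I -> residue_basis p I J b ->
  map_mx intr A = 0 :> 'M['F_p]_(m, N) <-> forall i, J ((A^Z *m b) i 0).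
Proof.
move=> idI [Ib _ indep]; rewrite map_mx_Fp_eq0 //; split=> [[B ->] i | JA].
  by apply: ideal_mulmx_p => l; apply: (ideal_sub idI).
apply/(map_mx_Fp_eq0 p_pr)/matrixP => i j; rewrite !mxE.
apply/eqP; rewrite intr_Fp_eq0 //.
suff /(_ j): forall j, (p%:Z %| row i A 0%R j)%Z by rewrite mxE.
apply: indep.
move: (JA i); congr J; rewrite !mxE; apply: eq_bigr => l _.
by rewrite !mxE.
Qed.

End IdealsAboveP.

(** * The residue field of a prime above [p] *)

Section ResidueField.
Variables (d : algC) (p : nat) (P : ideal_OK).
Hypotheses (p_pr : prime p) (primeP : is_prime_ideal d P) (Pp : P p%:R).

Let idP : is_ideal d P. Proof. by case: primeP. Qed.

Variables (h : nat) (w : 'cV[algC]_h).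
Hypothesis basis_w : residue_basis p (inOK d) P w.

(* Two distinct powers of [u] agree in the finite ring [O_K/P]. *)
Lemma prime_ideal_inverse u : inOK d u -> ~ P u ->
  exists2 v, inOK d v & P (1 - u * v).
Proof.
move=> Ou nPu; have [_ nP1 PM] := primeP; have [Ow span _] := basis_w.
have OX k : inOK d (u ^+ k).
  by elim: k => [|k IHk]; [exact: inOK1 | rewrite exprS; apply: inOKM].
have nPX k : ~ P (u ^+ k).
  by elim: k => [//|k IHk]; rewrite exprS => /PM[].
(* One more power than there are coefficient vectors modulo [p], so two powers of [u] share a
   vector. *)
pose n := #|{: 'rV['F_p]_h}|.+1.
have /fin_all_exists[c Pc] (k : 'I_n) :
  exists c : 'rV[int]_h, P (u ^+ k - (c^Z *m w) 0 0) by apply: span.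
pose F k : 'rV['F_p]_h := map_mx intr (c k).
have /injectivePn[i [j neq_ij eqF]] : ~~ injectiveb F.
  by apply/negP => /injectiveP/leq_card; rewrite card_ord ltnn.
wlog ltij : i j neq_ij eqF / (i < j)%N.
  move=> IH; case: (ltngtP i j) => [ij|ji|/val_inj eqij].
  - exact: IH ij.
  - by apply: IH ji; rewrite // eq_sym.
  - by rewrite eqij eqxx in neq_ij.
have Pij : P (u ^+ i - u ^+ j).
  have Pcij : P (((c i - c j)^Z *m w) 0 0).
    apply: (residue_basis_mulmx_eq0 p_pr idP Pp _ (inOK_ideal d) basis_w).1.
    by rewrite map_mxB; move: eqF; rewrite /F => ->; rewrite subrr.
  move: Pcij; rewrite map_mxB mulmxBl mxE [X in _ + X]mxE => Pcij.
  have := idealD idP (idealB idP (Pc i) (Pc j)) Pcij; congr P.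
  by ring.
(* As [u ^+ i * (1 - u ^+ (j - i))] lies in [P] and [u ^+ i] does not, primality puts the second
   factor in [P]. *)
exists (u ^+ (j - i.+1)) => //; rewrite -exprS -subSn // subSS.
have := Pij; rewrite -{1}(subnKC (ltnW ltij)) exprD -{1}[u ^+ i]mulr1 -mulrBr.
have O1 := idealB (inOK_ideal d) (inOK1 d) (OX (j - i)%N).
by case/(PM _ _ (OX i) O1) => // /nPX.
Qed.

Lemma mul_matrix_horner n (b : 'cV[algC]_n.+1) (M : 'M[int]_n.+1) q :
  inOK d d -> (forall i, P ((d *: b - M^Z *m b) i 0)) ->
  forall i, P (((map_poly intr q).[d] *: b - (horner_mx M q)^Z *m b) i 0).
Proof.
move=> Od PM; elim/poly_ind: q => [|q c IHq] i.
  by rewrite !rmorph0 horner0 scale0r mul0mx subrr mxE; apply: ideal0 idP.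
rewrite !rmorphD !rmorphM /= !map_polyC map_polyX horner_mx_C horner_mx_X.
rewrite !hornerE map_scalar_mx mulmxDl mul_scalar_mx -mulmxE /=.
set x := _.[d] in IHq *; set Q := (horner_mx M q)^Z in IHq *.
(* One Horner step: the new error is [d] times the old one plus [Q] applied to the error of [M]
   itself. *)
have -> : (x * d + c%:~R) *: b - (Q *m M^Z *m b + c%:~R *: b) =
          d *: (x *: b - Q *m b) + Q *m (d *: b - M^Z *m b).
  rewrite scalerDl opprD addrACA subrr addr0 mulmxBr scalerBr -scalemxAr.
  by rewrite mulmxA addrA subrK scalerA mulrC.
rewrite mxE; apply: (idealD idP).
  by rewrite mxE; apply: (idealMl idP).
exact: (ideal_mulmx idP).
Qed.

Hypothesis Od : inOK d d.

(** The left side says that [q(d)] kills every basis element modulo [P]. Expanding [1] in the basis,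
    this means that [q(d)] itself is in [P]. *)
Lemma horner_mx_Fp_eq0 n (b : 'cV[algC]_n.+1) (M : 'M[int]_n.+1) q :
  residue_basis p (inOK d) P b -> (forall i, P ((d *: b - M^Z *m b) i 0)) ->
  horner_mx (map_mx intr M) (map_poly intr q) = 0 :> 'M['F_p]_n.+1 <->
  P (map_poly intr q).[d].
Proof.
move=> basis_b PM; rewrite -map_horner_mx.
rewrite (residue_basis_mulmx_eq0 p_pr idP Pp _ (inOK_ideal d) basis_b).
have [Ob span _] := basis_b; have Pq := mul_matrix_horner q Od PM.
set x := _.[d] in Pq *.
have Ox : inOK d x := inOK_horner q Od.
split=> [PQ | Px i]; last first.
  have := idealB idP (idealMr idP (Ob i) Px) (Pq i).
  by congr P; rewrite !mxE; ring.
have Pxb i : P (x * b i 0).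
  by have := idealD idP (Pq i) (PQ i); congr P; rewrite !mxE; ring.
have [c Pc] := span 1 (inOK1 d).
have Pxc : P ((c^Z *m (x *: b)) 0 0).
  by apply: (ideal_mulmx idP) => l; rewrite mxE.
have := idealD idP (idealMl idP Ox Pc) Pxc; congr P.
by rewrite -scalemxAr [(x *: (_ *m _)) 0 0]mxE mulrBr mulr1 subrK.
Qed.

(** The minimal polynomial generates the kernel of evaluation at [d] from [F_p[X]] to [O_K/P]. As
    [P] is prime, a factorization of it has a factor already in that kernel. *)
Lemma mxminpoly_residue_irreducible n (b : 'cV[algC]_n.+1) (M : 'M[int]_n.+1) :
  residue_basis p (inOK d) P b -> (forall i, P ((d *: b - M^Z *m b) i 0)) ->
  irreducible_poly (mxminpoly (map_mx intr M : 'M['F_p]_n.+1)).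
Proof.
move=> basis_b PM; set A := map_mx _ _; set G := mxminpoly A.
have G0 : G != 0 by apply/monic_neq0/mxminpoly_monic.
have dvdG (r : {poly int}) : G %| map_poly intr r <-> P (map_poly intr r).[d].
  rewrite -(horner_mx_Fp_eq0 r basis_b PM) -/A.
  by split=> [/mxminpoly_minP | /mxminpoly_min].
split=> [|q q1 qG]; first by rewrite size_mxminpoly ltnS mxminpoly_nonconstant.
have /dvdpP[r DG] := qG; rewrite /eqp qG /=.
have [q0 Dq] := map_poly_Fp_surj q; have [r0 Dr] := map_poly_Fp_surj r.
have [_ _ PPM] := primeP.
have : P ((map_poly intr r0).[d] * (map_poly intr q0).[d]).
  by rewrite -hornerM -rmorphM; apply/dvdG; rewrite rmorphM /= Dq Dr -DG.
case/PPM; try exact: inOK_horner; move/dvdG; rewrite ?Dq // Dr => Gr; case/negP: q1.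
have r_neq0 : r != 0 by apply: contraNneq G0 => Er; rewrite DG Er mul0r.
have := Gr; rewrite DG -{2}[r]mul1r [r * q]mulrC dvdp_mul2r //.
by rewrite dvdp1.
Qed.

Lemma char_poly_residue_pow (M : 'M[int]_h) :
  (forall i, P ((d *: w - M^Z *m w) i 0)) ->
  exists (G : {poly 'F_p}) (k : nat),
    [/\ irreducible_poly G, (1 <= k)%N & char_poly (map_mx intr M) = G ^+ k].
Proof.
(* For [h = 0], the spanning property would put [1] in [P]. *)
case: h w basis_w M => [|n] b basis_b M PM.
  have [_ nP1 _] := primeP; have [_ span _] := basis_b.
  have [c] := span 1 (inOK1 d).
  by rewrite mxE big_ord0 subr0.
have irrG := mxminpoly_residue_irreducible basis_b PM.
have [k Dk] := char_poly_irreducible_pow irrG.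
exists (mxminpoly (map_mx intr M : 'M['F_p]_n.+1)), k; split=> //.
rewrite lt0n; apply/eqP => k0; have := size_char_poly (map_mx intr M : 'M['F_p]_n.+1).
by rewrite Dk k0 expr0 size_poly1.
Qed.

End ResidueField.

(** * Invertibility relative to [p], and successive quotients of ideals *)

(* [J] satisfies [I J = p O_K]. *)
Definition p_invertible d p (I : ideal_OK) := exists2 J, is_ideal d J &
  (forall a j, I a -> J j -> ideal_pOK d p (a * j)) /\ ideal_mul I J p%:R.

Lemma p_invertible_p d p I : is_ideal d I -> p_invertible d p I -> I p%:R.
Proof. by move=> idI [J idJ [_]]; apply: (ideal_mul_subl idI idJ). Qed.

Lemma p_invertible_eq d p I I' : ideal_eq I I' ->
  p_invertible d p I -> p_invertible d p I'.
Proof.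
move=> eqI [J idJ [IJ pIJ]]; exists J => //; split=> [a j /eqI|]; first exact: IJ.
have [s [IJs Dp]] := pIJ; exists s; split=> // u /IJs[Iu Ju].
by split=> //; apply/eqI.
Qed.

(** If [J] is the complement of [P I], then [P J] is the complement of [I]. *)
Lemma p_invertible_mulr d p P I : is_ideal d P -> is_ideal d I ->
  p_invertible d p (ideal_mul P I) -> p_invertible d p I.
Proof.
move=> idP idI [J idJ [PIJ pPIJ]]; have idp := pOK_ideal d p.
have idPJ := ideal_mul_ideal idP idJ; exists (ideal_mul P J) => //.
split=> [a x Ia|].
  apply: (ideal_mul_ind (Q := fun x => ideal_pOK d p (a * x))).
  - by rewrite mulr0; apply: ideal0 idp.
  - by move=> y z; rewrite mulrDr; apply: (idealD idp).
  - move=> y j Py Jj; rewrite mulrA [a * y]mulrC; apply: PIJ Jj.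
    exact: ideal_mul_mem.
have idIPJ := ideal_mul_ideal idI idPJ.
apply: ideal_mul_ind pPIJ; [exact: ideal0 idIPJ | exact: idealD idIPJ |].
move=> x j PIx Jj; move: PIx.
apply: (ideal_mul_ind (Q := fun x => ideal_mul I (ideal_mul P J) (x * j))).
- by rewrite mul0r; apply: ideal0 idIPJ.
- by move=> y z; rewrite mulrDl; apply: (idealD idIPJ).
- by move=> y a Py Ia; rewrite mulrAC mulrC; do !apply: ideal_mul_mem.
Qed.

(* [I/J] is a finite-dimensional [F_p]-space on which [d] acts with characteristic
   polynomial [Phi]. *)
Definition residue_filtration d p (J I : ideal_OK) (Phi : {poly 'F_p}) :=
  exists N (b : 'cV[algC]_N) (M : 'M[int]_N),
    [/\ residue_basis p I J b, forall i, J ((d *: b - M^Z *m b) i 0)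
      & char_poly (map_mx intr M) = Phi].

Lemma residue_filtration_eq d p J J' I I' (Phi : {poly 'F_p}) :
  ideal_eq J J' -> ideal_eq I I' -> residue_filtration d J I Phi ->
  residue_filtration d J' I' Phi.
Proof.
move=> eqJ eqI [N [b [M [[Ib span indep] JM DPhi]]]].
exists N, b, M; split=> // [|i]; last exact/eqJ.
split=> [i | x /eqI/span[c Jc] | c /eqJ]; [exact/eqI | | exact: indep].
by exists c; apply/eqJ.
Qed.

Lemma residue_filtration0 d p I :
  is_ideal d I -> residue_filtration d I I (1 : {poly 'F_p}).
Proof.
move=> idI; exists 0%N, 0, 0; split; last by rewrite /char_poly det_mx00.
  split=> [[]|x Ix|c _ []] //; exists 0.
  by rewrite mulmx0 mxE subr0.
by case.
Qed.

(** A lifted basis of [I/J] followed by one of [J/L] is a lifted basis of [I/L]. The span of the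
    second is stable under [d] modulo [L], so the matrix is block triangular and the characteristic
    polynomials multiply. *)
Lemma residue_filtration_trans d p L J I (Phi Psi : {poly 'F_p}) :
  prime p -> is_ideal d L -> is_ideal d J -> is_ideal d I ->
  L p%:R -> (forall x, L x -> J x) -> (forall x, J x -> I x) ->
  residue_filtration d L J Psi -> residue_filtration d J I Phi ->
  residue_filtration d L I (Phi * Psi).
Proof.
move=> p_pr idL idJ idI Lp sLJ sJI [N' [b' [M' [B' LM' <-]]]] [N [b [M [B JM <-]]]].
have [Jb' span' indep'] := B'; have [Ib span indep] := B.
have /fin_all_exists[A LA] (i : 'I_N) : exists c : 'rV[int]_N',
  L ((d *: b - M^Z *m b) i 0 - (c^Z *m b') 0 0) by apply: span'.
pose b2 := col_mx b b'; pose M2 := block_mx M (\matrix_i A i) 0 M'.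
exists (N + N')%N, b2, M2; split; last first.
- by rewrite map_block_mx map_mx0 char_poly_ublock.
- move=> i; rewrite map_block_mx mul_block_col map_mx0 mul0mx add0r.
  rewrite scale_col_mx opp_col_mx add_col_mx.
  case: (split_ordP i) => j ->; rewrite ?col_mxEu ?col_mxEd //.
  move: (LA j); congr L; rewrite opprD addrA [RHS]mxE; congr (_ + _).
  rewrite ![in RHS]mxE mxE; congr (- _); apply: eq_bigr => l _.
  by rewrite !mxE.
split=> [i | x Ix | c].
- by rewrite mxE; case: split => j; [apply: Ib | apply/sJI/Jb'].
- have [c Jc] := span x Ix; have [c' Lc'] := span' _ Jc.
  exists (row_mx c c'); rewrite map_row_mx mul_row_col.
  by rewrite [(_ *m b + _) 0 0]mxE opprD addrA.
rewrite -[c]hsubmxK map_row_mx mul_row_col; move: (lsubmx c) (rsubmx c).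
move=> {}c c' Lcc'; rewrite mxE in Lcc'.
have Jc' : J ((c'^Z *m b') 0 0) by apply: (ideal_mulmx idJ).
(* Modulo [J] only the [b] part survives, so [p] divides [c]; then that part lies in [L], which
   leaves a relation on [b'] alone. *)
have dvd_c : forall i, (p%:Z %| c 0%R i)%Z.
  apply: indep; have := idealB idJ (sLJ _ Lcc') Jc'.
  by rewrite addrK.
have Lc : L ((c^Z *m b) 0 0).
  have /(map_mx_Fp_eq0 p_pr)[c1 ->] : map_mx intr c = 0 :> 'M['F_p]_(_, _).
    apply/matrixP=> i j; rewrite !mxE [i]ord1; apply/eqP.
    by rewrite intr_Fp_eq0.
  by apply: (ideal_mulmx_p idL Lp) => l; apply: (ideal_sub idI).
have dvd_c' : forall i, (p%:Z %| c' 0%R i)%Z.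
  by apply: indep'; have := idealB idL Lcc' Lc; rewrite addrAC subrr add0r.
move=> i; case: (split_ordP i) => j ->.
  by rewrite row_mxEl.
by rewrite row_mxEr.
Qed.

(** * Products of primes dividing p *)

(* For [a] in [I] outside [PI], multiplication by [a] is an isomorphism from
   [O_K/P] onto [I/PI]. *)
Lemma residue_filtration_mul d p P I h (w : 'cV[algC]_h) (M : 'M[int]_h) :
  prime p -> is_prime_ideal d P -> is_ideal d I ->
  p_invertible d p (ideal_mul P I) ->
  residue_basis p (inOK d) P w -> (forall i, P ((d *: w - M^Z *m w) i 0)) ->
  residue_filtration d (ideal_mul P I) I (char_poly (map_mx intr M : 'M['F_p]_h)).
Proof.
move=> p_pr primeP idI invPI basis_w PM; have [idP nP1 PPM] := primeP.
have idPI := ideal_mul_ideal idP idI.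
have Pp : P p%:R by apply: (ideal_mul_subl idP idI); apply: p_invertible_p invPI.
have [J idJ [IJ pIJ]] := p_invertible_mulr idP idI invPI.
have p0 : p%:R != 0 :> algC by rewrite pnatr_eq0 -lt0n prime_gt0.
(* If [I = P I], then [p] lies in [I J = P I J], inside [p P], so [1] is in [P]. *)
have [a Ia nPIa] : exists2 a, I a & ~ ideal_mul P I a.
  apply: NNPP => noa; case: nP1.
  suff [y [Py Dp]] : exists y, P y /\ p%:R = p%:R * y.
    by rewrite (_ : 1 = y) //; apply: (mulfI p0); rewrite mulr1.
  move: pIJ; apply: (ideal_mul_ind (Q := fun x => exists y, P y /\ x = p%:R * y)).
  - by exists 0; rewrite mulr0; split=> //; apply: ideal0 idP.
  - move=> _ _ [y [Py ->]] [z [Pz ->]]; exists (y + z); rewrite mulrDr.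
    by split=> //; apply: (idealD idP).
  move=> x j Ix Jj; have PIx : ideal_mul P I x.
    by apply: NNPP => nPIx; case: noa; exists x.
  move: PIx; apply: (ideal_mul_ind (Q := fun x => exists y, P y /\ x * j = p%:R * y)).
  - by exists 0; rewrite mulr0 mul0r; split=> //; apply: ideal0 idP.
  - move=> x1 x2 [y [Py E1]] [z [Pz E2]]; exists (y + z).
    by rewrite mulrDl mulrDr E1 E2; split=> //; apply: (idealD idP).
  move=> y b Py Ib; have [z [Oz Dbj]] := IJ b j Ib Jj.
  by exists (y * z); split; [apply: (idealMr idP) | rewrite -mulrA Dbj mulrCA].
(* If [a J] were inside [p P], then [p a], which lies in [I (a J)], would be in [p P I], so [a]
   would be in [P I]. *)
have [j Jj nPja] : exists2 j, J j & ~ exists y, P y /\ a * j = p%:R * y.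
  apply: NNPP => noj; case: nPIa; rewrite -(mulKf p0 a) mulrC.
  suff [y [PIy ->]] : exists y, ideal_mul P I y /\ p%:R * a = p%:R * y.
    by rewrite mulrC mulKf.
  move: pIJ; apply: (ideal_mul_ind
    (Q := fun x => exists y, ideal_mul P I y /\ x * a = p%:R * y)).
  - by exists 0; rewrite mulr0 mul0r; split=> //; apply: ideal0 idPI.
  - move=> x1 x2 [y [Py E1]] [z [Pz E2]]; exists (y + z).
    by rewrite mulrDl mulrDr E1 E2; split=> //; apply: (idealD idPI).
  move=> b j Ib Jj.
  have [y [Py E]] : exists y, P y /\ a * j = p%:R * y.
    by apply: NNPP => ny; apply: noj; exists j.
  exists (y * b); split; first exact: ideal_mul_mem.
  by rewrite -mulrA [j * a]mulrC E mulrCA [b * y]mulrC.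
have [u [Ou Dja]] := IJ a j Ia Jj.
have nPu : ~ P u by move=> Pu; case: nPja; exists u.
have [v Ov Puv] := prime_ideal_inverse p_pr primeP Pp basis_w Ou nPu.
(* Injectivity: if [y] had an inverse [z] modulo [P], then [a = (1 - y z) a + (y a) z] would be in
   [P I]. *)
have kerP y : inOK d y -> ideal_mul P I (y * a) -> P y.
  move=> Oy PIya; apply: NNPP => nPy; case: nPIa.
  have [z Oz Pyz] := prime_ideal_inverse p_pr primeP Pp basis_w Oy nPy.
  have := idealD idPI (ideal_mul_mem Pyz Ia) (idealMr idPI Oz PIya).
  by congr (ideal_mul P I); ring.
have [Ow span indep] := basis_w.
have mulE n (c : 'M[int]_(n, h)) i : (c^Z *m (a *: w)) i 0 = (c^Z *m w) i 0 * a.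
  by rewrite -scalemxAr mxE mulrC.
exists h, (a *: w), M; split=> //; last first.
  move=> i; have := ideal_mul_mem (PM i) Ia; congr (ideal_mul P I).
  rewrite [RHS]mxE [X in _ = _ + X]mxE mulE [(d *: w - _) i 0]mxE.
  rewrite [(- (_ *m w)) i 0]mxE [(d *: w) i 0]mxE [(d *: (a *: w)) i 0]mxE.
  by rewrite [(a *: w) i 0]mxE; ring.
split=> [i | x Ix | c].
- by rewrite mxE mulrC; apply: (idealMl idI).
(* Surjectivity: with [y = x j / p] and [u = a j / p] one has [x u = y a], so [x] is congruent to
   [x u v = (y v) a] modulo [P I]. *)
- have [y [Oy Dxj]] := IJ x j Ix Jj.
  have [c Pc] := span _ (inOKM Oy Ov); exists c; rewrite mulE.
  have := idealD idPI (ideal_mul_mem Puv Ix) (ideal_mul_mem Pc Ia).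
  congr (ideal_mul P I).
  have Dx : x * u = y * a.
    by apply: (mulfI p0); rewrite mulrCA -Dja [RHS]mulrA -Dxj; ring.
  by rewrite !mulrBl mul1r [y * v * a]mulrAC -Dx; ring.
rewrite mulE => /kerP Pc; apply: indep; apply: Pc.
exact: (ideal_mulmx (inOK_ideal d)).
Qed.

Section IdealProducts.
Variables (d : algC) (p : nat) (T : Type) (P : T -> ideal_OK).
Variable (F : T -> {poly 'F_p}).
Hypotheses (p_pr : prime p) (idP : forall t, is_ideal d (P t)).
Hypothesis step : forall t I, is_ideal d I ->
  p_invertible d p (ideal_mul (P t) I) ->
  residue_filtration d (ideal_mul (P t) I) I (F t).

Local Notation prodP r := (ideal_prod d [seq P t | t <- r]).

Lemma ideal_prod_ideal r : is_ideal d (prodP r).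
Proof.
by elim: r => [|t r IHr] /=; [exact: inOK_ideal | exact: ideal_mul_ideal].
Qed.

(** One factor is split off at a time. The smaller products stay invertible by [p_invertible_mulr],
    so [step] handles each layer. *)
Lemma residue_filtration_prod r I : is_ideal d I ->
  p_invertible d p (ideal_mul (prodP r) I) ->
  residue_filtration d (ideal_mul (prodP r) I) I (\prod_(t <- r) F t).
Proof.
elim: r => [|t r IHr] idI invI /=.
  rewrite big_nil; apply: residue_filtration_eq (residue_filtration0 _ idI) => //.
  by move=> x; split; apply (ideal_mul1 idI x).
have idR := ideal_prod_ideal r; have idRI := ideal_mul_ideal idR idI.
have idPRI := ideal_mul_ideal (idP t) idRI.
have eqA := ideal_mulA (idP t) idR idI.
have invPRI := p_invertible_eq eqA invI.
have invRI := p_invertible_mulr (idP t) idRI invPRI.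
apply: (residue_filtration_eq (J := ideal_mul (P t) (ideal_mul (prodP r) I)) (I := I)).
- by move=> x; split; apply (eqA x).
- by [].
rewrite big_cons mulrC.
apply: (@residue_filtration_trans d p _ (ideal_mul (prodP r) I)) => //.
- exact: p_invertible_p invPRI.
- by move=> x; apply: (ideal_mul_subr (idP t) idRI).
- by move=> x; apply: (ideal_mul_subr idR idI).
- exact: step.
- exact: IHr.
Qed.

Lemma ideal_exp_ideal r e : is_ideal d (ideal_exp d (prodP r) e).
Proof.
elim: e => [|e IHe]; first exact: inOK_ideal.
exact: ideal_mul_ideal (ideal_prod_ideal r) IHe.
Qed.

Lemma residue_filtration_exp r e :
  p_invertible d p (ideal_exp d (prodP r) e) ->
  residue_filtration d (ideal_exp d (prodP r) e) (inOK d)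
    ((\prod_(t <- r) F t) ^+ e).
Proof.
elim: e => [|e IHe] inve; first exact: residue_filtration0 (inOK_ideal d).
have idR := ideal_prod_ideal r; have idRe := ideal_exp_ideal r e.
rewrite exprSr.
apply: (@residue_filtration_trans d p _ (ideal_exp d (prodP r) e)) => //.
- exact: ideal_exp_ideal r e.+1.
- exact: inOK_ideal.
- by apply: p_invertible_p inve; apply: ideal_exp_ideal r e.+1.
- by move=> x; apply: (ideal_mul_subr idR idRe).
- by move=> x; apply: (ideal_sub idRe).
- exact: residue_filtration_prod.
- exact/IHe/(p_invertible_mulr idR idRe).
Qed.

End IdealProducts.

(** * Bounded denominators of algebraic integers *)

Lemma map_ratr_intr (q : {poly int}) :
  map_poly (ratr : rat -> algC) (map_poly intr q) = map_poly intr q.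
Proof. by rewrite -map_poly_comp; apply: eq_map_poly => z /=; rewrite ratr_int. Qed.

Lemma Aint_horner (q : {poly int}) x : x \in Aint -> (map_poly intr q).[x] \in Aint.
Proof.
move=> Zx; rewrite horner_coef; apply: rpred_sum => i _.
by rewrite coef_map /= rpredM ?rpredX ?Aint_int.
Qed.

Lemma Aint_root_int (q : {poly int}) x :
  q \is monic -> root (map_poly intr q) x -> x \in Aint.
Proof.
move=> monq qx; apply: root_monic_Aint qx _ _; first exact: monic_map.
by apply/polyOverP => i; rewrite coef_map /= intr_int.
Qed.

Lemma Aint_minCpoly_int x : x \in Aint ->
  exists2 q : {poly int}, q \is monic & minCpoly x = map_poly intr q.
Proof.
move=> Zx; have [q Dq] : {q : {poly int} | minCpoly x = map_poly intr q}.
  exact: floorpP.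
exists q => //; apply/eqP/(intr_inj (R := algC)).
rewrite -lead_coef_map_inj //=; last exact: intr_inj.
by rewrite -Dq; apply/eqP/minCpoly_monic.
Qed.

(** Writing the minimal polynomial as [X r + c] gives [r(x) x = - c]. Here [c] is nonzero, since
    otherwise [r] would be a smaller annihilator of [x]; a sign makes the multiple positive. *)
Lemma Aint_dvd_nat x : x \in Aint -> x != 0 ->
  exists2 a, a \in Aint & exists2 m, (0 < m)%N & a * x = m%:R.
Proof.
move=> Zx x0; have [q monq Dq] := Aint_minCpoly_int Zx.
pose r := drop_poly 1 q.
have Dqr : q = r * 'X + (q`_0)%:P.
  apply/polyP => -[|i]; rewrite coefD coefMX coefC /= ?add0r //.
  by rewrite addr0 coef_drop_poly addn1.
have q0 : q != 0 by apply: monic_neq0.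
have Eqx : (map_poly intr r).[x] * x = - (q`_0)%:~R.
  apply/eqP; rewrite -addr_eq0; have := root_minCpoly x.
  by rewrite Dq {1}Dqr rmorphD rmorphM /= map_polyX map_polyC /root !hornerE.
have qx0 : q`_0 != 0.
  apply: contraTneq isT => q00; rewrite q00 oppr0 in Eqx.
  have [pQ [DpQ monpQ] minpQ] := minCpolyP x.
  have r0 : r != 0 by apply: contraNneq q0 => r0; rewrite Dqr r0 q00 mul0r addr0.
  have : pQ %| map_poly intr r.
    rewrite -minpQ map_ratr_intr; move/eqP: Eqx.
    by rewrite mulf_eq0 (negPf x0) orbF.
  move/dvdp_leq; rewrite map_poly_eq0_id0 ?intr_eq0 ?lead_coef_eq0 // => /(_ r0).
  have -> : size pQ = size q.
    rewrite -(size_map_poly (ratr : {rmorphism rat -> algC})) -DpQ Dq.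
    by rewrite size_map_inj_poly //; apply: intr_inj.
  rewrite size_map_inj_poly //; last exact: intr_inj.
  by rewrite Dqr q00 addr0 size_mulX // ltnn.
exists (- (map_poly intr r).[x] * (sgz q`_0)%:~R).
  by rewrite rpredM ?rpredN ?Aint_horner ?Aint_int.
exists (absz q`_0); first by rewrite absz_gt0.
by rewrite mulrAC mulNr Eqx opprK -rmorphM /= mulrC -abszEsg.
Qed.

Section MinimalPolynomial.
Variables (d : algC) (f : {poly int}).
Hypothesis minf : is_min_poly_Z d f.

Local Notation fQ := (map_poly intr f : {poly rat}).
Local Notation fC := (map_poly intr f : {poly algC}).
Local Notation "q ^C" := (map_poly (ratr : rat -> algC) q).

Lemma min_poly_dvd (q : {poly rat}) : root q^C d = (fQ %| q).
Proof.
have [monf [irrf fd]] := minf; have [m [Dm monm] minm] := minCpolyP d.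
rewrite minm; suff /eqP -> : m == fQ by [].
rewrite -eqp_monic ?monic_map //; case: irrf => _; apply.
  rewrite -(size_map_poly (ratr : {rmorphism rat -> algC})) -Dm.
  by rewrite neq_ltn size_minCpoly orbT.
by rewrite -minm map_ratr_intr.
Qed.

(** The integral minimal polynomial of [r(d)] composed with [r] vanishes at [d], so it is divisible
    by [f] and vanishes at [z]. *)
Lemma Aint_conjugate (r : {poly rat}) z :
  r^C.[d] \in Aint -> root fC z -> r^C.[z] \in Aint.
Proof.
move=> Zx fz; have [q monq Dq] := Aint_minCpoly_int Zx.
apply: (Aint_root_int monq); have := root_minCpoly r^C.[d].
rewrite Dq -!map_ratr_intr -!root_comp -!map_comp_poly min_poly_dvd.
move=> fqr; apply: root_dvdp fz.
by rewrite -(map_ratr_intr f) dvdp_map.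
Qed.

(** In characteristic zero the irreducible [f] is coprime to its nonzero derivative, so its complex
    roots are simple. *)
Lemma min_poly_roots : exists2 z : 'rV[algC]_(size f).-1,
  injective (z 0) & forall i, root fC (z 0 i).
Proof.
have [monf [irrf _]] := minf; have [r Dr] := closed_field_poly_normal fC.
have /monicP lead1 : fC \is monic by apply: monic_map.
rewrite lead1 scale1r in Dr.
have szr : (size f).-1 = size r.
  by rewrite -(size_map_inj_poly (@intr_inj algC)) // Dr size_prod_XsubC.
have uniq_r : uniq r.
  rewrite -separable_prod_XsubC -Dr -map_ratr_intr separable_map.
  rewrite unlock irreducible_poly_coprime //.
  have [gt1 _] := irrf.
  have f'0 : fQ^`() != 0.
    have [k Dk] : exists k, size fQ = k.+2.
      by case: (size fQ) gt1 => [|[|k]] // _; exists k.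
    apply/eqP => /polyP/(_ k); rewrite coef_deriv coef0 => /eqP.
    have /monicP := monic_map (intr : {rmorphism int -> rat}) monf.
    by rewrite lead_coefE Dk /= mulrn_eq0 => ->; rewrite oner_eq0.
  apply/negP => /(dvdp_leq f'0); rewrite leqNgt lt_size_deriv //.
  by rewrite -size_poly_gt0 (ltn_trans _ gt1).
exists (\row_i r`_i) => [i j|i].
  rewrite !mxE => /eqP; rewrite nth_uniq -?szr // => /eqP; exact: val_inj.
by rewrite mxE Dr root_prod_XsubC mem_nth -?szr.
Qed.

(** If [u] holds the coordinates of [x] in powers of [d] and [V] is the Vandermonde matrix of the
    conjugates, then [u V] lists the conjugates of [x]. By Cramer's rule [u] times [\det V] is
    integral; a multiple [m] of [\det V] then makes [m u] both rational and integral. *)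
Lemma bounded_denominators : exists2 m, (0 < m)%N & forall x, inOK d x ->
  exists c : 'rV[int]_(size f).-1,
    m%:R * x = (c^Z *m \col_i d ^+ i) 0 0.
Proof.
have [z injz rootz] := min_poly_roots; set n := (size f).-1 in z injz rootz *.
have [monf _] := minf.
pose V := Vandermonde n z.
have ZV i j : V i j \in Aint.
  by rewrite mxE rpredX // (Aint_root_int monf).
have V0 : \det V != 0.
  rewrite det_Vandermonde; apply/prodf_neq0 => i _; apply/prodf_neq0 => j ltij.
  rewrite subr_eq0; apply: contraTneq ltij => /injz ->.
  by rewrite ltnn.
have Zdet k (A : 'M[algC]_k) : (forall i j, A i j \in Aint) -> \det A \in Aint.
  move=> ZA; apply: rpred_sum => s _; rewrite rpredM ?rpredX ?rpredN1 //.
  by apply: rpred_prod => i _.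
have [a Za [m m_gt0 Dm]] := Aint_dvd_nat (Zdet _ _ ZV) V0.
exists m => // x [[q Dx] Zx].
pose r := q %% fQ; have szr : (size r <= n)%N.
  have fQ0 : fQ != 0 by apply/monic_neq0/monic_map.
  have := ltn_modp q fQ; rewrite fQ0 size_map_inj_poly //; last exact: intr_inj.
  rewrite /n; case: (size f) => //.
have Dxr : x = r^C.[d].
  have fd : fQ^C.[d] = 0.
    by rewrite map_ratr_intr; apply/rootP; have [_ []] := minf.
  by rewrite Dx {1}(divp_eq q fQ) rmorphD rmorphM hornerD hornerM /= fd mulr0 add0r.
pose u : 'rV[algC]_n := \row_i ratr r`_i.
have uE y : (u *m \col_(i < n) y ^+ i) 0 0 = r^C.[y].
  rewrite mxE (horner_coef_wide _ (n := n)); last by rewrite size_map_poly.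
  by apply: eq_bigr => i _; rewrite !mxE coef_map.
have Zmu i : m%:R * u 0 i \is a Num.int.
  apply: Cint_rat_Aint.
    by rewrite rpredM ?mxE ?Crat_rat // rpred_nat.
  rewrite -Dm -mulrA rpredM // mulrC.
  have -> : u 0 i * \det V = (u *m V *m \adj V) 0 i.
    by rewrite -mulmxA mul_mx_adj mul_mx_scalar [RHS]mxE mulrC.
  rewrite mxE rpred_sum // => j _; rewrite rpredM //.
    have -> : (u *m V) 0 j = r^C.[z 0 j].
      by rewrite -uE !mxE; apply: eq_bigr => k _; rewrite !mxE.
    by apply: Aint_conjugate; rewrite // -Dxr.
  rewrite mxE rpredM ?rpredX ?rpredN1 //; apply: Zdet => k l.
  by rewrite !mxE rpredX // (Aint_root_int monf).
have /fin_all_exists[c Dc] (i : 'I_n) : exists c : int, m%:R * u 0 i = c%:~R.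
  exact/intrP.
exists (\row_i c i); rewrite Dxr -uE !mxE mulr_sumr.
by apply: eq_bigr => i _; rewrite !mxE -Dc mxE mulrA.
Qed.

End MinimalPolynomial.

(** * The quotient of the ring of integers by p *)

Section ResidueBasisOfP.
Variables (d : algC) (f : {poly int}) (p N : nat) (b : 'cV[algC]_N).
Hypotheses (p_pr : prime p) (Od : inOK d d) (minf : is_min_poly_Z d f).
Hypothesis basis_b : residue_basis p (inOK d) (ideal_pOK d p) b.

Local Notation n := (size f).-1.
Local Notation v := (\col_(i < n) d ^+ i).

Let Ov i : inOK d (v i 0).
Proof.
rewrite mxE; elim: (i : nat) => [|k IHk]; first exact: inOK1.
by rewrite exprS; apply: inOKM.
Qed.

Lemma padic_expansion k x : inOK d x ->
  exists (c : 'rV[int]_N) y, inOK d y /\ x = (c^Z *m b) 0 0 + p%:R ^+ k * y.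
Proof.
have [_ span _] := basis_b; elim: k x => [|k IHk] x Ox.
  by exists 0, x; rewrite map_mx0 mul0mx mxE add0r expr0 mul1r.
have [c [y [/IHk[c' [y' [Oy' ->]]] Dx]]] := span x Ox.
exists (c + p%:Z *: c'), y'; split=> //.
rewrite map_mxD map_mxZ mulmxDl -scalemxAl [(_ *m b + _) 0 0]mxE.
rewrite [(_ *: (_ *m b)) 0 0]mxE exprS -[x](subrK ((c^Z *m b) 0 0)) Dx /=; ring.
Qed.

(** Descent: independence modulo [p] lets a relation be divided by [p] indefinitely. *)
Lemma residue_basis_free (c : 'rV[int]_N) : c^Z *m b = 0 -> c = 0.
Proof.
have p0 : p%:R != 0 :> algC by rewrite pnatr_eq0 -lt0n prime_gt0.
have [_ _ indep] := basis_b.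
have descent k : forall c : 'rV[int]_N, c^Z *m b = 0 ->
    exists c', c = (p ^ k)%:Z *: c'.
  elim: k => [|k IHk] {}c cb0; first by exists c; rewrite scale1r.
  have [c1 Dc] : exists c1, c = p%:Z *: c1.
    apply/(map_mx_Fp_eq0 p_pr)/matrixP=> i j; rewrite !mxE [i]ord1; apply/eqP.
    rewrite intr_Fp_eq0 //; apply: indep; rewrite cb0 mxE.
    exact: ideal0 (pOK_ideal d p).
  have [|c2 Dc1] := IHk c1.
    move/eqP: cb0; rewrite Dc map_mxZ -scalemxAl scaler_eq0 /=.
    by rewrite (negPf p0) => /eqP.
  by exists c2; rewrite Dc Dc1 scalerA -PoszM -expnS.
move=> cb0; apply/matrixP => i j; rewrite [i]ord1 [RHS]mxE.
apply/eqP; apply: contraT => cj0.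
(* Descending as many times as the coefficient is large suffices, because [p ^ k] exceeds [k]. *)
pose k := absz (c 0 j); have [c' Dc] := descent k _ cb0.
have Dk : k = (p ^ k * absz (c' 0%R j))%N by rewrite {1}/k Dc mxE abszM.
have k_gt0 : (0 < k)%N by rewrite absz_gt0.
have : (p ^ k <= k)%N.
  rewrite {2}Dk leq_pmulr // lt0n; apply: contraTneq k_gt0 => c'0.
  by rewrite Dk c'0 muln0.
by rewrite leqNgt ltn_expl // prime_gt1.
Qed.

(* If [m O_K] lies in [Z[d]] and [m = p ^ a * m'] with [m'] prime to [p],
   expanding [p]-adically to order [a + 1] gives [m' v = C b + p A v]; here
   [det (m' - p A)] is prime to [p]. *)
Lemma residue_basis_span r (X : 'cV[algC]_r) : (forall i, inOK d (X i 0)) ->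
  exists2 T : int, T%:~R != 0 :> 'F_p &
    exists C : 'M[int]_(r, N), T%:~R *: X = C^Z *m b.
Proof.
have [m m_gt0 denm] := bounded_denominators minf.
have [m' copm' Dm] := pfactor_coprime p_pr m_gt0; set a := logn p m in Dm.
have p0 : p%:R != 0 :> algC by rewrite pnatr_eq0 -lt0n prime_gt0.
have m'0 : m'%:Z%:~R != 0 :> 'F_p.
  by rewrite intr_Fp_eq0 // dvdzE /= -prime_coprime.
have expand s (Y : 'cV[algC]_s) : (forall i, inOK d (Y i 0)) ->
    exists (C : 'M[int]_(s, N)) (A : 'M[int]_(s, n)),
      m'%:R *: Y = C^Z *m b + p%:R *: (A^Z *m v).
  move=> OY.
  have /fin_all_exists[cA DcA] (i : 'I_s) : exists cA : 'rV[int]_N * 'rV[int]_n,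
    m'%:R * Y i 0 = (cA.1^Z *m b) 0 0 + p%:R * (cA.2^Z *m v) 0 0.
    have [c [y [Oy ->]]] := padic_expansion a.+1 (OY i).
    have [c' Dc'] := denm y Oy; exists (m'%:Z *: c, c') => /=.
    rewrite -Dc' map_mxZ -scalemxAl [(_ *: (_ *m b)) 0 0]mxE Dm natrM natrX exprS /=.
    ring.
  exists (\matrix_i (cA i).1), (\matrix_i (cA i).2).
  apply/matrixP => i j; rewrite [j]ord1 [LHS]mxE DcA [RHS]mxE.
  rewrite [(_ *: (_ *m v)) i 0]mxE; congr (_ + _ * _).
    by rewrite !mxE; apply: eq_bigr => l _; rewrite !mxE.
  by rewrite !mxE; apply: eq_bigr => l _; rewrite !mxE.
have [C [A DCA]] := expand _ _ Ov.
pose W := m'%:Z%:M - p%:Z *: A; pose T := \det W.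
have T0 : T%:~R != 0 :> 'F_p.
  rewrite -det_map_mx map_mxB map_scalar_mx.
  rewrite ((map_mx_Fp_eq0 p_pr (p%:Z *: A)).2 _); last by exists A.
  by rewrite subr0 det_scalar expf_neq0.
have DTv : T%:~R *: v = (\adj W *m C)^Z *m b.
  have DW : W^Z *m v = C^Z *m b.
    rewrite map_mxB map_scalar_mx map_mxZ mulmxBl mul_scalar_mx -scalemxAl.
    by rewrite DCA addrK.
  rewrite map_mxM -mulmxA -DW mulmxA -map_mxM mul_adj_mx map_scalar_mx.
  by rewrite mul_scalar_mx.
move=> OX; have [C1 [A1 DX]] := expand _ _ OX.
(* The factor [T] absorbs the error term of [X], since [T v] is an integral combination of [b]. *)
exists (T * m'%:Z); first by rewrite rmorphM mulf_neq0.
exists (T *: C1 + p%:Z *: (A1 *m (\adj W *m C))).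
rewrite rmorphM -scalerA /= DX scalerDr.
have -> : T%:~R *: (p%:R *: (A1^Z *m v)) = p%:R *: (A1^Z *m (T%:~R *: v)).
  by rewrite -scalemxAr !scalerA mulrC.
by rewrite DTv map_mxD !map_mxZ [(A1 *m _)^Z]map_mxM mulmxDl -!scalemxAl mulmxA.
Qed.

Lemma char_poly_residue_basis (M : 'M[int]_N) :
  (forall i, ideal_pOK d p ((d *: b - M^Z *m b) i 0)) ->
  char_poly (map_mx intr M) = map_poly intr f :> {poly 'F_p}.
Proof.
move=> pM; have [monf [irrf fd]] := minf; have [Ob _ _] := basis_b.
have int_neq0 (z : int) : z%:~R != 0 :> 'F_p -> z != 0.
  by apply: contraNneq => ->.
have b_neq0 : b != 0.
  have O1 (i : 'I_1) : inOK d ((1%:M : 'cV[algC]_1) i 0).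
    by rewrite [i]ord1 mxE; apply: inOK1.
  have [T T0 [C]] := residue_basis_span O1.
  apply: contra_eqN => /eqP ->; rewrite mulmx0 scaler_eq0 intr_eq0.
  by rewrite (negPf (int_neq0 _ T0)) /= -mxrank_eq0 mxrank1.
(* From [m b = A v] and [T v = C b], freeness of [b] gives [A C = T m] as a scalar matrix of size
   [N]. It has rank [N] and factors through dimension [n]. *)
have le_Nn : (N <= n)%N.
  have [m m_gt0 denm] := bounded_denominators minf.
  have /fin_all_exists[A DA] (i : 'I_N) : exists c : 'rV[int]_n,
    m%:R * b i 0 = (c^Z *m v) 0 0 by apply: denm.
  have mb : m%:R *: b = (\matrix_i A i)^Z *m v.
    apply/matrixP => i j; rewrite [j]ord1 [LHS]mxE DA !mxE.
    by apply: eq_bigr => l _; rewrite !mxE.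
  have [T T0 [C DC]] := residue_basis_span Ov.
  have DAC : (\matrix_i A i) *m C = (T * m%:Z)%:M.
    apply/eqP; rewrite -subr_eq0; apply/eqP/row_matrixP => i; rewrite row0.
    apply: residue_basis_free; rewrite map_row -row_mul.
    rewrite map_mxB map_scalar_mx map_mxM mulmxBl -mulmxA -DC mul_scalar_mx.
    rewrite -scalemxAr rmorphM -scalerA -scalerBr.
    by rewrite mb subrr scaler0 row0.
  have := mulmx_max_rank (map_mx (intr : int -> rat) (\matrix_i A i)) (map_mx intr C).
  rewrite -map_mxM DAC map_scalar_mx -scalemx1 mxrank_scale_nz ?mxrank1 //.
  by rewrite intr_eq0 mulf_neq0 ?(int_neq0 _ T0) //= eqz_nat -lt0n.
have Odb i : inOK d ((d *: b) i 0) by rewrite mxE; apply: inOKM.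
have [T T0 [C DC]] := residue_basis_span Odb.
have Tq0 : T%:~R != 0 :> rat by rewrite intr_eq0 int_neq0.
pose D : 'M[rat]_N := T%:~R^-1 *: map_mx intr C.
have charD : char_poly D = map_poly intr f.
  (* The nonzero column [b] is an eigenvector of [D] for [d], so [f] divides; [N <= n] then forces
     equality. *)
  have fD : map_poly intr f %| char_poly D.
    rewrite -(min_poly_dvd minf) map_char_poly.
    apply: (eigenvector_root_char b_neq0).
    rewrite map_mxZ fmorphV /= ratr_int -map_mx_comp -scalemxAl.
    rewrite (_ : map_mx _ C = C^Z); first last.
      by apply: eq_map_mx => z /=; rewrite ratr_int.
    by rewrite -DC scalerK // intr_eq0 int_neq0.
  apply/esym/eqP; rewrite -eqp_monic ?char_poly_monic ?monic_map //.
  rewrite -dvdp_size_eqp // eqn_leq dvdp_leq ?monic_neq0 ?char_poly_monic //=.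
  rewrite size_char_poly size_map_inj_poly //; last exact: intr_inj.
  by rewrite -(prednK (n := size f)) // size_poly_gt0 monic_neq0.
have DPsi : scaled_char_poly T C = T ^+ N *: f.
  apply: (map_inj_poly (@intr_inj rat)) => //.
  rewrite map_scaled_char_poly map_polyZ rmorphXn /= -charD -scaled_char_polyZ.
  by rewrite /D scalerA mulfV // scale1r.
(* Both [T M] and [C] express [T d b] modulo [p], and coordinates in [b] are unique modulo [p]. *)
have TM : T%:~R *: map_mx intr M = map_mx intr C :> 'M['F_p]_N.
  apply/eqP; rewrite -subr_eq0 -map_mxZ -map_mxB; apply/eqP.
  have idp := pOK_ideal d p.
  have pp : ideal_pOK d p p%:R by exists 1; rewrite mulr1; split=> //; apply: inOK1.
  apply/(residue_basis_mulmx_eq0 p_pr idp pp _ (inOK_ideal d) basis_b) => i.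
  rewrite map_mxB map_mxZ mulmxBl -DC -scalemxAl -scalerBr -opprB scalerN.
  rewrite mxE; apply: (idealN idp); rewrite mxE.
  by apply: (idealMl idp) (pM i); apply: inOK_int.
apply: (scalerI (expf_neq0 N T0)); rewrite -scaled_char_polyZ TM.
by rewrite -map_scaled_char_poly DPsi map_polyZ rmorphXn.
Qed.

End ResidueBasisOfP.

(** * Comparison of the two characteristic polynomials *)

Lemma residue_filtration_pOK d f p (Phi : {poly 'F_p}) :
  prime p -> inOK d d -> is_min_poly_Z d f ->
  residue_filtration d (ideal_pOK d p) (inOK d) Phi -> Phi = map_poly intr f.
Proof.
move=> p_pr Od minf [N [b [M [basis_b pM <-]]]].
exact: char_poly_residue_basis basis_b _ pM.
Qed.

Lemma ideal_prod_sub d (T : eqType) (P : T -> ideal_OK) (r : seq T) t x :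
  (forall t, is_ideal d (P t)) -> t \in r ->
  ideal_prod d [seq P t | t <- r] x -> P t x.
Proof.
move=> idP; elim: r => // s r IHr; have idR := ideal_prod_ideal idP r.
rewrite inE => /predU1P[-> | tr] /=; first exact: (ideal_mul_subl (idP s) idR).
by move/(ideal_mul_subr (idP s) idR); apply: IHr.
Qed.

Lemma p_invertible_pOK d p : p_invertible d p (ideal_pOK d p).
Proof.
have idp := pOK_ideal d p; exists (inOK d); first exact: inOK_ideal.
split=> [a j pa Oj|]; first exact: (idealMr idp).
rewrite -[X in ideal_mul _ _ X]mulr1; apply: ideal_mul_mem (inOK1 d).
by exists 1; rewrite mulr1; split=> //; apply: inOK1.
Qed.

Theorem mainTheorem1 (d : algC) (f : {poly int}) (p : nat)
    (g e h : nat) (P : 'I_g -> ideal_OK) :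
  d \in Aint ->
  is_min_poly_Z d f ->
  galois_over_Q d f ->
  prime p ->
  (forall i, is_prime_ideal d (P i)) ->
  (forall i j, i != j -> ~ ideal_eq (P i) (P j)) ->
  ideal_eq (ideal_pOK d p)
           (ideal_exp d (ideal_prod d [seq P i | i <- enum 'I_g]) e) ->
  (forall i, residue_degree d p (P i) h) ->
  exists F : 'I_g -> {poly 'F_p},
    [/\ map_poly (fun z : int => z%:~R : 'F_p) f = (\prod_(i < g) F i) ^+ e,
        forall i, size (F i) = h.+1
      & forall i, exists (G : {poly 'F_p}) (e' : nat),
          [/\ irreducible_poly G, (1 <= e')%N & F i = G ^+ e']].
Proof.
move=> Zd minf _ p_pr primeP _ eqP resP.
have Od : inOK d d by split; [exact: inK_root | exact: Zd].
have idP i : is_ideal d (P i) by case: (primeP i).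
have eqP' : ideal_eq (ideal_exp d (ideal_prod d [seq P i | i <- enum 'I_g]) e)
                     (ideal_pOK d p) by move=> x; split=> /eqP.
have inve := p_invertible_eq eqP (p_invertible_pOK d p).
have filt_f (Phi : {poly 'F_p}) :
    residue_filtration d (ideal_exp d (ideal_prod d [seq P i | i <- enum 'I_g]) e)
      (inOK d) Phi -> map_poly intr f = Phi.
  move/(residue_filtration_eq eqP' (fun x => iff_refl _)).
  by move/(residue_filtration_pOK p_pr Od minf).
(* For [e = 0] the filtration is trivial and [f] would reduce to [1], although it is monic of
   positive degree. *)
have e_gt0 : (0 < e)%N.
  case: e filt_f {eqP eqP' inve} => // /(_ 1).
  move/(_ (residue_filtration0 p (inOK_ideal d)))/(congr1 (size \o polyseq)).
  have [monf [[]]] := minf; rewrite size_map_inj_poly //; last exact: intr_inj.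
  move=> gt1 _ _ /=; rewrite size_poly1 size_map_poly_id0.
    by move=> fE; rewrite fE in gt1.
  by rewrite (monicP monf) oner_eq0.
have Pp i : P i p%:R.
  apply: (ideal_prod_sub idP (mem_enum _ i)).
  have idR := ideal_prod_ideal idP (enum 'I_g).
  have := p_invertible_p (ideal_exp_ideal idP (enum 'I_g) e) inve.
  rewrite -(prednK e_gt0); apply: (ideal_mul_subl idR).
  exact: ideal_exp_ideal idP _ _.
(* [F i] is the characteristic polynomial of [d] on [O_K/P_i]; its degree, its shape and its role in
   the filtration are recorded together. *)
have /fin_all_exists[F DF] (i : 'I_g) : exists F : {poly 'F_p},
  [/\ size F = h.+1,
      exists (G : {poly 'F_p}) (e' : nat),
        [/\ irreducible_poly G, (1 <= e')%N & F = G ^+ e']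
    & forall I, is_ideal d I -> p_invertible d p (ideal_mul (P i) I) ->
        residue_filtration d (ideal_mul (P i) I) I F].
  have [w basis_w] := residue_degree_basis (resP i).
  have [M PM] := mul_matrix_exists (inOK_ideal d) Od basis_w.
  exists (char_poly (map_mx intr M)); split; first exact: size_char_poly.
    exact: char_poly_residue_pow p_pr (primeP i) (Pp i) _ _ basis_w Od _ PM.
  by move=> I idI invI; apply: residue_filtration_mul basis_w PM.
exists F; split=> [|i|i]; [|by case: (DF i)|by case: (DF i)].
rewrite -big_enum /=; apply: filt_f; apply: residue_filtration_exp => // i I.
by case: (DF i) => _ _; apply.
Qed.
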